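(* Let $Q(z)$ be an $n\times n$ matrix function meromorphic on $\bar{\mathbb{C}}$ with $\det Q(z)\not\equiv0$. Let $\beta_1,\ldots,\beta_l$ be the distinct finite poles of $Q$, with respective orders $t_1,\ldots,t_l$, and let $L(z)$ be the matrix polynomial $$L(z)=(z-\beta_1)^{t_1}\cdots(z-\beta_l)^{t_l}\,Q(z).$$ Let $\alpha\in\sigma_0(Q)$ be a zero (but not a pole) of $Q(z)$. A function $\varphi(z)$ is a root function of $Q(z)$ at $\alpha$ if and only if it is a root function of the same order of the matrix polynomial $L(z)$ (at $\alpha$). Therefore, the root functions of meromorphic matrix functions are essentially matrix polynomials.
   Context: $\bar{\mathbb{C}}:=\mathbb{C}\cup\{\infty\}$. A matrix function is meromorphic on $\bar{\mathbb{C}}$ if its only singularities on $\bar{\mathbb{C}}$ are poles; it then has only finitely many finite poles, and $L$ is a matrix polynomial. Root functions. Let $Q$ be an $n\times n$ meromorphic matrix function on $\bar{\mathbb{C}}$ and $\alpha\in\mathbb{C}$. Suppose that an $n$-dimensional vector function $\varphi(z)$ satisfies: (a) $\varphi(\alpha)\neq 0$; (b) $(Q(z)\varphi(z))^{(l)}\to 0$ as $z\to\alpha$, for $0\le l\le m-1$, where $l,m-1\in\mathbb{N}\cup\{0\}$. Then $\varphi(z)$ is called a root function of $Q(z)$ of order at least $m$ at the critical point (or zero) $\alpha$. If $m$ is the maximal number for which (b) holds, then $\varphi(z)$ is a root function of exact order $m$ at $\alpha$. $\sigma_0(Q)$ denotes the set of all finite zeros of $Q$, i.e. of all $\alpha\in\mathbb{C}$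 at which $Q$ has a root function. *)

(* Defs.v *)
From HB Require Import structures.
From mathcomp Require Import all_boot all_order all_algebra.
From mathcomp Require Import all_classical all_reals all_analysis.
From mathcomp Require Import complex.

Set Implicit Arguments.
Unset Strict Implicit.
Unset Printing Implicit Defensive.

Import Order.TTheory GRing.Theory Num.Theory numFieldNormedType.Exports.
Local Open Scope classical_set_scope.
Local Open Scope ring_scope.
Local Open Scope complex_scope.

(* The cast makes R[i] inherit the topology and norm that MathComp-Analysis
   attaches to every numFieldType. *)
Definition Cplx (R : realType) : numFieldType := R[i].

(* Scalars are complex, so derivable f z 1 is complex differentiability. *)
Definition holomorphic_at (R : realType) (p q : nat)
    (f : Cplx R -> 'M[Cplx R]_(p, q)) (a : Cplx R) : Prop :=
  \forall z \near a, derivable f z 1.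

(* Complex derivatives of all orders near a; by Cauchy's theorem every function
   that is holomorphic near a satisfies this. *)
Definition smooth_at (R : realType) (p q : nat)
    (f : Cplx R -> 'M[Cplx R]_(p, q)) (a : Cplx R) : Prop :=
  \forall z \near a, forall k : nat, derivable (derive1n k f) z 1.

(* Near a (but not at a), f z = (z - a)^-t H z with H holomorphic at a; the
   value of f at a itself is irrelevant. *)
Definition laurent_form (R : realType) (p q : nat)
    (f : Cplx R -> 'M[Cplx R]_(p, q)) (a : Cplx R) (t : nat)
    (H : Cplx R -> 'M[Cplx R]_(p, q)) : Prop :=
  holomorphic_at H a /\
  \forall z \near a^', f z = (z - a) ^- t *: H z.

Definition pole_of_order (R : realType) (p q : nat)
    (f : Cplx R -> 'M[Cplx R]_(p, q)) (a : Cplx R) (t : nat) : Prop :=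
  (0 < t)%N /\ exists H, laurent_form f a t H /\ H a != 0.

Definition is_pole (R : realType) (p q : nat)
    (f : Cplx R -> 'M[Cplx R]_(p, q)) (a : Cplx R) : Prop :=
  exists t : nat, pole_of_order f a t.

(* A matrix function is a total function whose values at its poles are
   irrelevant. The point at infinity is the origin for w |-> f (1 / w), whose
   singularity there must be removable or a pole; f has no value at infinity,
   hence the last disjunct does not require regularity at w = 0. *)
Definition meromorphic_sphere (R : realType) (p q : nat)
    (f : Cplx R -> 'M[Cplx R]_(p, q)) : Prop :=
  (forall a : Cplx R, holomorphic_at f a \/ is_pole f a) /\
  (is_pole (fun w => f w^-1) 0 \/ exists H, laurent_form (fun w => f w^-1) 0 0 H).

Definition mxpoly_fun (R : realType) (p q : nat)
    (A : 'M[{poly Cplx R}]_(p, q)) (z : Cplx R) : 'M[Cplx R]_(p, q) :=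
  map_mx (fun c => c.[z]) A.

(* F^(l)(z) --> 0 as z --> a for 0 <= l < m. As the library derivative is total,
   existence of F^(l) on a punctured neighbourhood of a is stated explicitly. *)
Definition vanishes_to_order (R : realType) (p q : nat)
    (F : Cplx R -> 'M[Cplx R]_(p, q)) (a : Cplx R) (m : nat) : Prop :=
  forall l : nat, (l < m)%N ->
    (\forall z \near a^', forall k : nat, (k < l)%N -> derivable (derive1n k F) z 1) /\
    derive1n l F z @[z --> a^'] --> (0 : 'M[Cplx R]_(p, q)).

(* Root function of Q of order at least m at a. The only regularity demanded of
   phi, besides the derivatives of Q phi, is continuity at a: without it the
   value phi a could be chosen freely and phi a != 0 would say nothing. *)
Definition root_function (R : realType) (n : nat)
    (Q : Cplx R -> 'M[Cplx R]_n) (a : Cplx R) (m : nat)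
    (phi : Cplx R -> 'cV[Cplx R]_n) : Prop :=
  [/\ (0 < m)%N, {for a, continuous phi}, phi a != 0
    & vanishes_to_order (fun z => Q z *m phi z) a m].

Definition root_function_exact (R : realType) (n : nat)
    (Q : Cplx R -> 'M[Cplx R]_n) (a : Cplx R) (m : nat)
    (phi : Cplx R -> 'cV[Cplx R]_n) : Prop :=
  root_function Q a m phi /\
  forall k : nat, root_function Q a k phi -> (k <= m)%N.

Definition sigma0 (R : realType) (n : nat)
    (Q : Cplx R -> 'M[Cplx R]_n) : set (Cplx R) :=
  [set a | exists m phi, root_function Q a m phi].

(* Main.v *)
Require Import Defs.
From HB Require Import structures.
From mathcomp Require Import all_boot all_order all_algebra.
From mathcomp Require Import all_classical all_reals all_analysis.
From mathcomp Require Import complex.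

Set Implicit Arguments.
Unset Strict Implicit.
Unset Printing Implicit Defensive.

Import Order.TTheory GRing.Theory Num.Theory numFieldNormedType.Exports.
Local Open Scope classical_set_scope.
Local Open Scope ring_scope.

(** The proof is local at [alpha] and soft: the only consequence of
    meromorphy that matters is that, near [alpha], the values of [L] and [Q]
    differ by the scalar factor [c = \prod_i ('X - beta_i) ^ t_i], which is a
    polynomial with [c.[alpha] != 0].

    Order of vanishing is handled by a recursion: [F] vanishes to order [m + 1]
    at [a] iff [F] tends to 0 at [a] and, for [m > 0], [F'] exists near [a] and
    vanishes to order [m] ([vanishes_to_orderS]). With it, the Leibniz rule
    [(A F)' = A' F + A F'] shows by induction that multiplication by a matrix
    polynomial preserves vanishing to order [m] ([vanishes_to_order_mulmx]).
    Read as [c F' = (c F)' - c' F], the same rule shows that division by a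
    scalar polynomial [c] with [c.[a] != 0] preserves it too
    ([vanishes_to_orderZ_inv]). Applied to [L phi = c (Q phi)], these two facts
    give the equivalence of root functions of [Q] and of [L] at every order, and
    hence at the exact order.

    For the last claim, whether a smooth [phi] is a root function of the matrix
    polynomial [L] of order at least [m] depends only on the derivatives of
    [phi] at [alpha] of orders 0 to [m - 1]: if these agree for [f] and [g], then
    [f - g] vanishes to order [m], hence so does [L (f - g)]
    ([root_function_eq_jets]). The Taylor polynomial of [phi] of degree [m]
    agrees with [phi] in the derivatives of orders 0 to [m], so the two functions
    satisfy the root condition of order [m] together, and that of order [m + 1]
    together; this transfers exactness. *)

(** * Limits and derivatives of matrix-valued functions *)

Section Analysis.
Variable K : numFieldType.

(** Punctured neighbourhoods are open because points are closed; this is what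
    makes an identity near [a] survive differentiation near [a]. *)
Lemma near_dnbhs (a : K) (P : set K) :
  (\forall z \near a^', P z) -> \forall z \near a^', \forall w \near z, P w.
Proof.
move=> aP.
have {}aP : \forall z \near a, \forall w \near z, w != a -> P w.
  exact: (@near_join _ a (fun w => w != a -> P w)).
apply: filterS aP => z Pz za; apply: filterS2 Pz _ => [w|]; first exact.
apply: open_nbhs_nbhs; split => //=.
have /closed_openC := accessible_closed_set1
  (hausdorff_accessible (@norm_hausdorff K K)) (x := a).
by congr open; apply/seteqP; split => x /= /eqP.
Qed.

(** A basic neighbourhood of a matrix is a box of entrywise neighbourhoods. *)
Lemma cvg_mx (T : Type) (F : set_system T) (FF : Filter F) (p q : nat)
    (f : T -> 'M[K]_(p, q)) (A : 'M[K]_(p, q)) :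
  (forall i j, f x i j @[x --> F] --> A i j) -> f x @[x --> F] --> A.
Proof.
move=> fA B [P AP PB].
have FP : F (fun x => forall i j, P i j (f x i j)).
  by apply: filter_forall => i; apply: filter_forall => j; exact: fA.
by apply: (@filterS _ F _ _ _ _ FP) => x Px; exact: (PB (f x) Px).
Qed.

Lemma cvg_mulmx (T : Type) (F : set_system T) (FF : Filter F) (p q r : nat)
    (f : T -> 'M[K]_(p, q)) (g : T -> 'M[K]_(q, r))
    (A : 'M[K]_(p, q)) (B : 'M[K]_(q, r)) :
  f x @[x --> F] --> A -> g x @[x --> F] --> B ->
  f x *m g x @[x --> F] --> A *m B.
Proof.
move=> fA gB; apply: cvg_mx => i j; rewrite mxE.
under eq_cvg do rewrite mxE.
apply: (cvg_big add_continuous) => k _; apply: cvgM.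
  exact: (cvg_comp _ _ fA (@coord_continuous K p q i k A)).
exact: (cvg_comp _ _ gB (@coord_continuous K q r k j B)).
Qed.

Lemma cvg_is_derive (V : normedModType K) (f : K -> V) (x : K) (df : V) :
  h^-1 *: (f (h *: 1 + x) - f x) @[h --> 0^'] --> df -> is_derive x 1 f df.
Proof. by move=> H; split; [apply/cvg_ex; exists df | exact/cvg_lim]. Qed.

Lemma is_derive_mulmx (p q r : nat) (f : K -> 'M[K]_(p, q))
    (g : K -> 'M[K]_(q, r)) (x : K) (df : 'M[K]_(p, q)) (dg : 'M[K]_(q, r)) :
  is_derive x 1 f df -> is_derive x 1 g dg ->
  is_derive x 1 (fun z => f z *m g z) (df *m g x + f x *m dg).
Proof.
move=> [fx <-] [gx <-].
have gc : {for x, continuous g}.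
  exact/differentiable_continuous/derivable1_diffP.
have gc' : g (h *: 1 + x) @[h --> 0^'] --> g x.
  apply: (@cvg_comp _ _ _ (fun h : K => h *: 1 + x) g _ (nbhs x)) => //.
  rewrite -[in nbhs x](add0r x); apply: cvgD; last exact: cvg_cst.
  rewrite -[in nbhs 0](scale0r (1 : K)); apply: cvgZ; last exact: cvg_cst.
  exact: nbhs_dnbhs.
apply: cvg_is_derive.
(* Discrete Leibniz rule: a b - a0 b0 = (a - a0) b + a0 (b - b0). *)
apply: cvg_trans (cvgD (cvg_mulmx _ fx gc') (cvg_mulmx _ (cvg_cst (f x)) gx)).
apply: near_eq_cvg; near=> h => /=.
by rewrite fctE -scalemxAl -scalemxAr -scalerDr mulmxBl mulmxBr addrA subrK.
Unshelve. all: by end_near. Qed.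

(** Through [a *: M = a%:M *m M], this deduces the product rule for scaling from
    the one for [*m]. *)
Lemma is_derive_scalar_mx (p : nat) (f : K -> K) (x df : K) :
  is_derive x 1 f df -> is_derive x 1 (fun z => (f z)%:M : 'M[K]_p) df%:M.
Proof.
move=> [fx <-].
apply: cvg_is_derive; apply: cvg_mx => i j; rewrite mxE.
under eq_cvg do rewrite !mxE -mulrnBl mulrnAr.
case: eqP => _; rewrite ?mulr1n ?mulr0n; first exact: fx.
exact: cvg_cst.
Qed.

Lemma is_derive_scalemx (p q : nat) (f : K -> K) (g : K -> 'M[K]_(p, q))
    (x df : K) (dg : 'M[K]_(p, q)) :
  is_derive x 1 f df -> is_derive x 1 g dg ->
  is_derive x 1 (fun z => f z *: g z) (df *: g x + f x *: dg).
Proof.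
move=> fx gx; rewrite -!mul_scalar_mx.
rewrite (_ : (fun z => _) = fun z => (f z)%:M *m g z).
  by apply: is_derive_mulmx; exact: is_derive_scalar_mx.
by apply/funext => z; rewrite mul_scalar_mx.
Qed.

Lemma is_derive_horner (p : {poly K}) (x : K) :
  is_derive x 1 (horner p) p^`().[x].
Proof.
elim/poly_ind: p => [|p c IH].
  rewrite deriv0 horner0 (_ : horner 0 = cst 0); first exact: is_derive_cst.
  by apply/funext => y; rewrite horner0.
have -> : horner (p * 'X + c%:P) = horner p * id + cst c.
  by apply/funext => y; rewrite !hornerE.
apply: is_derive_eq.
rewrite derivD derivM derivX derivC mulr1 !hornerE /GRing.scale /=.
by rewrite addrC mulr1 mulrC.
Qed.

Lemma continuous_horner (c : {poly K}) : continuous (horner c).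
Proof.
move=> a; apply/differentiable_continuous/derivable1_diffP.
by have [] := is_derive_horner c a.
Qed.

Lemma near_horner_neq0 (c : {poly K}) (a : K) :
  c.[a] != 0 -> \forall z \near a, c.[z] != 0.
Proof. exact: (@cvgr_neq0 K K _ (nbhs a) _ _ _ (@continuous_horner c a)). Qed.

End Analysis.

(** * Derivatives of matrix polynomials and order of vanishing *)

Section VanishingOrder.
Variable R : realType.
Notation C := (Cplx R).
Implicit Types a : C.

Lemma is_derive_mxpoly_fun (p q : nat) (A : 'M[{poly C}]_(p, q)) (x : C) :
  is_derive x 1 (mxpoly_fun A) (mxpoly_fun (map_mx (@deriv C) A) x).
Proof.
apply: cvg_is_derive; apply: cvg_mx => i j.
have [dA dAE] := is_derive_horner (A i j) x.
rewrite !mxE -dAE; apply: cvg_trans dA; apply: near_eq_cvg; near=> h.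
by rewrite !mxE.
Unshelve. all: by end_near. Qed.

Lemma derive1_mxpoly_fun (p q : nat) (A : 'M[{poly C}]_(p, q)) :
  derive1 (mxpoly_fun A) = mxpoly_fun (map_mx (@deriv C) A).
Proof.
by apply/funext => x; rewrite derive1E; have [_] := is_derive_mxpoly_fun A x.
Qed.

Lemma derive1n_mxpoly_fun (p q k : nat) (A : 'M[{poly C}]_(p, q)) :
  derive1n k (mxpoly_fun A) = mxpoly_fun (map_mx (derivn k) A).
Proof.
elim: k => [|k IH].
  by rewrite derive1n0; congr mxpoly_fun; apply/matrixP => i j; rewrite mxE.
rewrite derive1nS IH derive1_mxpoly_fun; congr mxpoly_fun.
by apply/matrixP => i j; rewrite !mxE derivnS.
Qed.

Lemma cvg_mxpoly_fun (p q : nat) (A : 'M[{poly C}]_(p, q)) a :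
  mxpoly_fun A z @[z --> a^'] --> mxpoly_fun A a.
Proof.
apply: cvg_within_filter.
apply: differentiable_continuous; apply/derivable1_diffP.
by have [] := is_derive_mxpoly_fun A a.
Qed.

Lemma near_eq_derive1 (p q : nat) (F G : C -> 'M[C]_(p, q)) a :
  (\forall z \near a^', F z = G z) ->
  \forall z \near a^', derive1 F z = derive1 G z.
Proof.
move=> /near_dnbhs; apply: filterS => z FG.
by rewrite !derive1E; exact: near_eq_derive.
Qed.

Lemma vanishes_to_order0 (p q : nat) (F : C -> 'M[C]_(p, q)) a :
  vanishes_to_order F a 0.
Proof. by move=> l; rewrite ltn0 => /notF[]. Qed.

(** Peeling off one derivative lets statements about all orders be proved by
    induction from facts about first derivatives. Vanishing to order 1 says
    nothing about differentiability, whence the guard [0 < m]. *)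
Lemma vanishes_to_orderS (p q m : nat) (F : C -> 'M[C]_(p, q)) a :
  vanishes_to_order F a m.+1 <->
  [/\ F z @[z --> a^'] --> (0 : 'M[C]_(p, q)),
      (0 < m)%N -> \forall z \near a^', derivable F z 1
    & vanishes_to_order (derive1 F) a m].
Proof.
split=> [vF|[F0 dF vF]].
  split; first by have [] := vF 0 isT.
    by move=> m0; have [+ _] := vF 1 m0; apply: filterS => z /(_ 0 isT).
  move=> l lm; have [+] := vF l.+1 lm; rewrite derive1Sn => vl cl; split=> //.
  by apply: filterS vl => z vl k kl; rewrite -derive1Sn; exact: vl.
case=> [_|l lm].
  split; last exact: F0.
  by apply: filterE => z k; rewrite ltn0 => /notF[].
have [vl cl] := vF l lm; rewrite derive1Sn; split=> //.
have := dF (leq_ltn_trans (leq0n l) lm).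
apply: filterS2 vl => z vl dFz [_|k kl]; first exact: dFz.
by rewrite derive1Sn; exact: vl.
Qed.

Lemma near_eq_vanishes_to_order (p q m : nat) (F G : C -> 'M[C]_(p, q)) a :
  (\forall z \near a^', F z = G z) ->
  vanishes_to_order F a m -> vanishes_to_order G a m.
Proof.
elim: m F G => [|m IH] F G FG; first by move=> _; exact: vanishes_to_order0.
move=> /vanishes_to_orderS[F0 dF vF].
apply/vanishes_to_orderS; split.
- by apply: cvg_trans F0; exact: near_eq_cvg.
- move=> /dF; apply: filterS2 (near_dnbhs FG) => z FGz; exact: near_eq_derivable.
- exact: IH (near_eq_derive1 FG) vF.
Qed.

Lemma vanishes_to_order_le (p q m k : nat) (F : C -> 'M[C]_(p, q)) a :
  (k <= m)%N -> vanishes_to_order F a m -> vanishes_to_order F a k.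
Proof. by move=> km vF l lk; apply: vF; exact: leq_trans km. Qed.

Lemma vanishes_to_orderD (p q m : nat) (F G : C -> 'M[C]_(p, q)) a :
  vanishes_to_order F a m -> vanishes_to_order G a m ->
  vanishes_to_order (fun z => F z + G z) a m.
Proof.
elim: m F G => [|m IH] F G; first by move=> _ _; exact: vanishes_to_order0.
move=> /vanishes_to_orderS[F0 dF vF].
move=> /vanishes_to_orderS[G0 dG vG]; apply/vanishes_to_orderS; split.
- by rewrite -[0]addr0; exact: cvgD.
- move=> m0; apply: filterS2 (dF m0) (dG m0) => z; exact: derivableD.
case: m => [|m] in IH dF vF dG vG *; first exact: vanishes_to_order0.
apply: near_eq_vanishes_to_order (IH _ _ vF vG).
apply: filterS2 (dF isT) (dG isT) => z dFz dGz.
by rewrite !derive1E -deriveD.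
Qed.

(** Leibniz rule by induction on [m], with [A] generalized because the term
    [A' F] calls for the induction hypothesis at [A']. *)
Lemma vanishes_to_order_mulmx (p q r m : nat) (A : 'M[{poly C}]_(p, q))
    (F : C -> 'M[C]_(q, r)) a :
  vanishes_to_order F a m ->
  vanishes_to_order (fun z => mxpoly_fun A z *m F z) a m.
Proof.
elim: m A F => [|m IH] A F vF; first exact: vanishes_to_order0.
have /vanishes_to_orderS[F0 dF dvF] := vF.
have dAF z : derivable F z 1 -> is_derive z 1 (fun z => mxpoly_fun A z *m F z)
    (mxpoly_fun (map_mx (@deriv C) A) z *m F z + mxpoly_fun A z *m derive1 F z).
  move=> dFz; apply: is_derive_mulmx; first exact: is_derive_mxpoly_fun.
  by rewrite derive1E; exact: derivableP.
apply/vanishes_to_orderS; split.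
- rewrite -(mulmx0 _ (mxpoly_fun A a)); apply: cvg_mulmx F0.
  exact: cvg_mxpoly_fun.
- by move=> m0; apply: filterS (dF m0) => z /dAF[].
case: m => [|m] in IH vF dF dvF *; first exact: vanishes_to_order0.
apply: near_eq_vanishes_to_order (vanishes_to_orderD
  (IH (map_mx (@deriv C) A) F (vanishes_to_order_le (leqnSn _) vF)) (IH A _ dvF)).
by apply: filterS (dF isT) => z /dAF[_ <-]; rewrite derive1E.
Qed.

Lemma vanishes_to_orderZ (p q m : nat) (c : {poly C})
    (F : C -> 'M[C]_(p, q)) a :
  vanishes_to_order F a m -> vanishes_to_order (fun z => c.[z] *: F z) a m.
Proof.
move=> /(vanishes_to_order_mulmx c%:M); apply: near_eq_vanishes_to_order.
apply: nearW => z; rewrite -mul_scalar_mx; congr (_ *m _).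
apply/matrixP => i j; rewrite !mxE.
by case: eqP => _; rewrite ?hornerMn ?mulr1n ?mulr0n ?horner0.
Qed.

(** Division is reduced to multiplication by polynomials, so that the higher
    derivatives of [1 / c] never have to be computed. *)
Lemma vanishes_to_orderZ_inv (p q m : nat) (c : {poly C})
    (F : C -> 'M[C]_(p, q)) a : c.[a] != 0 ->
  vanishes_to_order (fun z => c.[z] *: F z) a m -> vanishes_to_order F a m.
Proof.
move=> ca; have c0 : \forall z \near a^', c.[z] != 0.
  by apply: nbhs_dnbhs; exact: near_horner_neq0.
have FE (G : C -> 'M[C]_(p, q)) :
    \forall z \near a^', (c.[z])^-1 *: (c.[z] *: G z) = G z.
  by apply: filterS c0 => z cz; rewrite scalerA mulVf// scale1r.
elim: m F => [|m IH] F vcF; first exact: vanishes_to_order0.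
have /vanishes_to_orderS[cF0 dcF vdcF] := vcF.
have dF : (0 < m)%N -> \forall z \near a^', derivable F z 1.
  move=> m0; apply: filterS3 c0 (dcF m0) (near_dnbhs (FE F)) => z cz dz FEz.
  apply: near_eq_derivable FEz _.
  have dV : derivable (fun y => (c.[y])^-1) z 1.
    apply: derivableV => //; by have [] := is_derive_horner c z.
  by have [] := is_derive_scalemx (derivableP dV) (derivableP dz).
apply/vanishes_to_orderS; split; [|exact: dF|].
- apply: cvg_trans (near_eq_cvg (FE F)) _.
  rewrite -(scaler0 _ (c.[a])^-1); apply: cvgZ cF0.
  by apply: cvgV => //; apply: cvg_within_filter; exact: continuous_horner.
case: m => [|m] in IH vcF dcF vdcF dF *; first exact: vanishes_to_order0.
apply: (IH).
(* c F' = (c F)' - c' F, where F vanishes to the lower order by induction. *)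
have vF := IH F (vanishes_to_order_le (leqnSn _) vcF).
have := vanishes_to_orderD vdcF (vanishes_to_orderZ (- c^`()) vF).
apply: near_eq_vanishes_to_order.
apply: filterS (dF isT) => z dFz.
have [_ dcFz] := is_derive_scalemx (is_derive_horner c z) (derivableP dFz).
by rewrite derive1E dcFz -derive1E hornerN scaleNr addrAC subrr add0r.
Qed.

(** Together with the existence of Taylor polynomials, this replaces Taylor's
    formula with remainder. *)
Lemma vanishes_to_order_eq_jets (p q m : nat) (f g : C -> 'M[C]_(p, q)) a :
  smooth_at f a -> smooth_at g a ->
  (forall k, (k < m)%N -> derive1n k f a = derive1n k g a) ->
  vanishes_to_order (fun z => f z - g z) a m.
Proof.
elim: m f g => [|m IH] f g sf sg fg; first exact: vanishes_to_order0.
have cts (h : C -> 'M[C]_(p, q)) : smooth_at h a -> h z @[z --> a^'] --> h a.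
  move=> /nbhs_singleton /(_ 0) dh; apply: cvg_within_filter.
  exact/differentiable_continuous/derivable1_diffP.
have smooth_derive1 (h : C -> 'M[C]_(p, q)) :
    smooth_at h a -> smooth_at (derive1 h) a.
  by apply: filterS => z dh k; rewrite -derive1Sn; exact: dh.
have dfg : \forall z \near a^', is_derive (z : C) 1 f (derive1 f z) /\
    is_derive z 1 g (derive1 g z).
  apply: nbhs_dnbhs; apply: filterS2 sf sg => z /(_ 0) df /(_ 0) dg.
  rewrite !derive1E; split; [exact: (derivableP df)|exact: (derivableP dg)].
apply/vanishes_to_orderS; split.
- have := cvgB (cts f sf) (cts g sg).
  by rewrite (fg 0 isT : f a = g a) subrr; exact.
- by move=> _; apply: filterS dfg => z [[df _] [dg _]]; exact: (derivableB df dg).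
apply: near_eq_vanishes_to_order
  (IH _ _ (smooth_derive1 _ sf) (smooth_derive1 _ sg) _).
  apply: filterS dfg => z [df dg].
  by have [_ <-] := is_deriveB df dg; rewrite derive1E.
by move=> k km; have := fg k.+1 km; rewrite !derive1Sn; exact.
Qed.

Lemma smooth_at_mxpoly_fun (p q : nat) (A : 'M[{poly C}]_(p, q)) a :
  smooth_at (mxpoly_fun A) a.
Proof.
apply: filterE => z k; rewrite derive1n_mxpoly_fun.
by have [] := is_derive_mxpoly_fun (map_mx (derivn k) A) z.
Qed.

(** * Taylor polynomials *)

Lemma derivn_comp_XsubC (q : {poly C}) a k :
  (q \Po ('X - a%:P))^`(k) = q^`(k) \Po ('X - a%:P).
Proof.
elim: k => [//|k IH].
by rewrite !derivnS IH deriv_comp derivXsubC mulr1.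
Qed.

(** The witness is the Taylor sum with prescribed coefficients [d k / k!],
    written as a polynomial in ['X] recentred at [a]. *)
Lemma exists_mxpoly_jet (p q m : nat) (d : nat -> 'M[C]_(p, q)) a :
  exists A : 'M[{poly C}]_(p, q), forall k, (k <= m)%N ->
    derive1n k (mxpoly_fun A) a = d k.
Proof.
exists (\matrix_(i, j) ((\poly_(k < m.+1) (d k i j / k`!%:R)) \Po ('X - a%:P))).
move=> k km; rewrite derive1n_mxpoly_fun; apply/matrixP => i j; rewrite !mxE.
rewrite derivn_comp_XsubC horner_comp hornerXsubC subrr horner_coef0.
rewrite coef_derivn addn0 coef_poly ltnS km ffactnn.
by rewrite -[LHS]mulr_natr mulfVK.
Qed.

(** * Root functions *)

Lemma root_function_le (n m k : nat) (Q : C -> 'M[C]_n) (phi : C -> 'cV[C]_n) a :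
  (0 < k <= m)%N -> root_function Q a m phi -> root_function Q a k phi.
Proof.
move=> /andP[k0 km] [_ cphi phia vphi].
exact: (And4 k0 cphi phia (vanishes_to_order_le km vphi)).
Qed.

(** The orders of a root function form an initial segment, so maximality of [m]
    only has to be tested at [m + 1]. *)
Lemma root_function_exactP (n m : nat) (Q : C -> 'M[C]_n)
    (phi : C -> 'cV[C]_n) a :
  root_function_exact Q a m phi <->
  root_function Q a m phi /\ ~ root_function Q a m.+1 phi.
Proof.
split=> [[rm mmax]|[rm nrS]]; split; [exact: rm| |exact: rm|].
  by move=> /mmax; rewrite ltnn.
move=> k rk; rewrite leqNgt; apply/negP => mk; apply: nrS.
by apply: root_function_le rk; rewrite ltn0Sn.
Qed.

Lemma root_function_scale (n m : nat) (c : {poly C}) (Q L : C -> 'M[C]_n)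
    (phi : C -> 'cV[C]_n) a : c.[a] != 0 ->
  (\forall z \near a^', L z = c.[z] *: Q z) ->
  root_function Q a m phi <-> root_function L a m phi.
Proof.
move=> ca LQ.
have LQphi : \forall z \near a^', L z *m phi z = c.[z] *: (Q z *m phi z).
  by apply: filterS LQ => z ->; rewrite scalemxAl.
split=> -[m0 cphi phia v]; apply: (And4 m0 cphi phia).
  apply: near_eq_vanishes_to_order (vanishes_to_orderZ c v).
  by apply: filterS LQphi => z ->.
apply: (vanishes_to_orderZ_inv ca).
exact: near_eq_vanishes_to_order LQphi v.
Qed.

(** [L g = L f + L (g - f)], and the second summand vanishes to order [m]. *)
Lemma root_function_eq_jets (n m : nat) (L : 'M[{poly C}]_n)
    (f g : C -> 'cV[C]_n) a :
  smooth_at f a -> smooth_at g a ->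
  (forall k, (k < m)%N -> derive1n k f a = derive1n k g a) ->
  root_function (mxpoly_fun L) a m f -> root_function (mxpoly_fun L) a m g.
Proof.
move=> sf sg fg [m0 _ fa vf]; split; first exact: m0.
- have /nbhs_singleton /(_ 0) dg := sg.
  exact/differentiable_continuous/derivable1_diffP.
- by rewrite -[g a]/(derive1n 0 g a) -(fg 0 m0).
have gf k : (k < m)%N -> derive1n k g a = derive1n k f a by move=> /fg.
have := vanishes_to_orderD vf
  (vanishes_to_order_mulmx L (vanishes_to_order_eq_jets sg sf gf)).
apply: near_eq_vanishes_to_order; apply: nearW => z.
by rewrite -mulmxDr addrC subrK.
Qed.

End VanishingOrder.

Theorem proposition2p7 (R : realType) (n : nat)
    (Q : Cplx R -> 'M[Cplx R]_n)
    (hQ : meromorphic_sphere Q)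
    (hdet : exists z : Cplx R, ~ is_pole Q z /\ \det (Q z) != 0)
    (l : nat) (beta : 'I_l -> Cplx R) (t : 'I_l -> nat)
    (beta_inj : injective beta)
    (beta_pole : forall i : 'I_l, pole_of_order Q (beta i) (t i))
    (beta_all : forall b : Cplx R, is_pole Q b -> exists i : 'I_l, b = beta i)
    (L : 'M[{poly Cplx R}]_n)
    (hL : forall z : Cplx R, ~ is_pole Q z ->
       mxpoly_fun L z = (\prod_(i < l) (z - beta i) ^+ t i) *: Q z)
    (alpha : Cplx R)
    (halpha : sigma0 Q alpha) (halpha_pole : ~ is_pole Q alpha) :
  [/\ forall (m : nat) (phi : Cplx R -> 'cV[Cplx R]_n),
        root_function Q alpha m phi <-> root_function (mxpoly_fun L) alpha m phi,
      forall (m : nat) (phi : Cplx R -> 'cV[Cplx R]_n),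
        root_function_exact Q alpha m phi <->
        root_function_exact (mxpoly_fun L) alpha m phi
    & forall (m : nat) (phi : Cplx R -> 'cV[Cplx R]_n),
        smooth_at phi alpha -> root_function_exact Q alpha m phi ->
        exists p : 'cV[{poly Cplx R}]_n,
          (forall k : nat, (k <= m)%N ->
             derive1n k (mxpoly_fun p) alpha = derive1n k phi alpha) /\
          root_function_exact Q alpha m (mxpoly_fun p)].
Proof.
pose c : {poly Cplx R} := \prod_(i < l) ('X - (beta i)%:P) ^+ t i.
have cE z : c.[z] = \prod_(i < l) (z - beta i) ^+ t i.
  by rewrite horner_prod; apply: eq_bigr => i _; rewrite horner_exp hornerXsubC.
have c_alpha : c.[alpha] != 0.
  rewrite cE; apply/prodf_neq0 => i _; rewrite expf_neq0 // subr_eq0.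
  by apply/eqP => ab; apply: halpha_pole; rewrite ab; exists (t i).
have not_pole z : c.[z] != 0 -> ~ is_pole Q z.
  move=> + /beta_all[i zE]; rewrite cE (bigD1 i) //= zE subrr.
  by have [t0 _] := beta_pole i; rewrite expr0n gtn_eqF // mul0r eqxx.
(* All poles are roots of [c], so [hL] applies wherever [c] does not vanish. *)
have LQ : \forall z \near alpha^', mxpoly_fun L z = c.[z] *: Q z.
  apply: nbhs_dnbhs; apply: filterS (near_horner_neq0 c_alpha) => z cz.
  by rewrite cE; exact/hL/not_pole.
have QL m phi :=
  @root_function_scale R n m c Q (mxpoly_fun L) phi alpha c_alpha LQ.
have QLexact m phi : root_function_exact Q alpha m phi <->
    root_function_exact (mxpoly_fun L) alpha m phi.
  by split=> /root_function_exactP[r nr]; apply/root_function_exactP;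
    split; do ?[exact/QL | move=> /QL].
split; [exact: QL|exact: QLexact|] => m phi sphi.
move=> /QLexact /root_function_exactP[rphi nrphi].
have [p pE] := exists_mxpoly_jet m (fun k => derive1n k phi alpha) alpha.
have sp := smooth_at_mxpoly_fun p alpha.
exists p; split; first exact: pE.
apply/QLexact/root_function_exactP; split.
  apply: (root_function_eq_jets sphi sp _ rphi) => k /ltnW km.
  exact: (esym (pE k km)).
move=> rp; apply: nrphi; apply: (root_function_eq_jets sp sphi _ rp) => k km.
exact: pE.
Qed.
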